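(* Let $m(a,b)$ be a symmetric mean in two variables. Then there exists a symmetric mean $M(a,b,c)$ in three variables such that $M$ is type 2 invariant with respect to $m$, i.e. $M(a,b,m(a,b))=m(a,b)$ for all $(a,b)\in\mathbb{R}_+^2$.
   Context: $\mathbb{R}_+^n=\{(a_1,\dots,a_n)\in\mathbb{R}^n: a_i>0\ \forall i\}$. A mean in $n$ variables is a continuous function $m$ on $\mathbb{R}_+^n$ with $\min(a_1,\dots,a_n)\le m(a_1,\dots,a_n)\le\max(a_1,\dots,a_n)$. It is symmetric if it is unchanged by every permutation of its arguments. *)

(* Defs.v *)
From HB Require Import structures.
From mathcomp Require Import all_boot all_order all_algebra all_fingroup.
From mathcomp Require Import all_classical all_reals all_analysis.

Set Implicit Arguments.
Unset Strict Implicit.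
Unset Printing Implicit Defensive.

Import Order.TTheory GRing.Theory Num.Theory.
Import numFieldNormedType.Exports.

Local Open Scope classical_set_scope.
Local Open Scope ring_scope.

(* A real function on the positive orthant is encoded as a total function on
   row vectors; every condition below only concerns its values on
   [pos_orthant], so the values elsewhere are irrelevant. *)
Definition pos_orthant {R : realType} {n : nat} : set 'rV[R]_n :=
  [set a | forall i, 0 < a ord0 i].

(* The number of variables is [n.+1], so that the minimum and the maximum of
   the entries make sense; the default value [a ord0 ord0] of the iterated
   operators is itself an entry of [a]. *)
Definition is_mean (R : realType) (n : nat) (m : 'rV[R]_n.+1 -> R) : Prop :=
  {within pos_orthant, continuous m} /\
  forall a : 'rV[R]_n.+1, pos_orthant a ->
    \big[Num.min/a ord0 ord0]_(i < n.+1) a ord0 i <= m a /\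
    m a <= \big[Num.max/a ord0 ord0]_(i < n.+1) a ord0 i.

Definition is_symmetric (R : realType) (n : nat) (m : 'rV[R]_n -> R) : Prop :=
  forall (s : 'S_n) (a : 'rV[R]_n), pos_orthant a -> m (col_perm s a) = m a.

Definition vec2 (R : realType) (a b : R) : 'rV[R]_2 :=
  \row_(i < 2) [:: a; b]`_i.

Definition vec3 (R : realType) (a b c : R) : 'rV[R]_3 :=
  \row_(i < 3) [:: a; b; c]`_i.

Definition type2_invariant (R : realType) (M : 'rV[R]_3 -> R)
    (m : 'rV[R]_2 -> R) : Prop :=
  forall a b : R, 0 < a -> 0 < b -> M (vec3 a b (m (vec2 a b))) = m (vec2 a b).

(* Main.v *)
Require Import Defs.
From mathcomp Require Import all_boot all_order all_algebra all_fingroup.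
From mathcomp Require Import all_classical all_reals all_analysis.

(* The value m(a, b) lies between a and b, so it is the median of the triple
   (a, b, m(a, b)): the median of three numbers is a symmetric mean that is
   type 2 invariant with respect to every mean m. *)

Set Implicit Arguments.
Unset Strict Implicit.
Unset Printing Implicit Defensive.

Import Order.TTheory GRing.Theory Num.Theory.
Import numFieldNormedType.Exports.

Local Open Scope classical_set_scope.
Local Open Scope ring_scope.

(** Taking the largest of the pairwise minima avoids sorting: continuity and the bounds of a mean
    are inherited from [Num.min] and [Num.max]. *)
Definition median (R : realType) (x y z : R) : R :=
  Num.max (Num.max (Num.min x y) (Num.min y z)) (Num.min x z).

(** The two adjacent transpositions, here and in [median_swapr], generate all permutations of three
    arguments. *)
Lemma median_swapl (R : realType) (x y z : R) : median y x z = median x y z.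
Proof. by rewrite /median (minC y x) -!maxA (maxC (Num.min x z)). Qed.

Lemma median_swapr (R : realType) (x y z : R) : median x z y = median x y z.
Proof.
by rewrite /median (minC z y) maxC maxA (maxC (Num.min x y)) -maxA maxC.
Qed.

(** By [median_swapl] one may take [x <= y]; the pairwise minima are then [x], [z], [x], and the
    largest of them is [z]. *)
Lemma median_between (R : realType) (x y z : R) :
  Num.min x y <= z -> z <= Num.max x y -> median x y z = z.
Proof.
wlog le_xy : x y / x <= y => [hwlog|].
  case: (leP x y) => [|/ltW] le; first by move: (hwlog x y le); rewrite min_l ?max_r.
  by move: (hwlog y x le); rewrite median_swapl min_l ?max_r.
rewrite min_l ?max_r // => le_xz le_zy.
by rewrite /median !(min_l le_xy, min_r le_zy, min_l le_xz) (max_r le_xz) max_l.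
Qed.

Definition median_row (R : realType) (a : 'rV[R]_3) : R :=
  median (a ord0 (inord 0)) (a ord0 (inord 1)) (a ord0 (inord 2)).

Lemma median_row_continuous (R : realType) : continuous (@median_row R).
Proof.
have coord i : continuous (fun a : 'rV[R]_3 => a ord0 i : R^o).
  exact: coord_continuous.
have min_coord i j :
    continuous (fun a : 'rV[R]_3 => Num.min (a ord0 i) (a ord0 j) : R^o).
  by move=> a; apply: (continuous_min (coord i a) (coord j a)).
move=> a; apply: (continuous_max _ (min_coord _ _ a)).
exact: (continuous_max (min_coord _ _ a) (min_coord _ _ a)).
Qed.

(** Each entry lies between the iterated minimum and maximum, hence so does any expression built
    from entries by [Num.min] and [Num.max]. *)
Lemma median_row_is_mean (R : realType) : is_mean (@median_row R).
Proof.
split; first exact/continuous_subspaceT/median_row_continuous.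
move=> a _; rewrite /median_row /median.
split.
  by rewrite !le_max !le_min !bigmin_le_cond.
by rewrite !ge_max !ge_min !le_bigmax_cond.
Qed.

Lemma median_row_symmetric (R : realType) : is_symmetric (@median_row R).
Proof.
move=> s a _; rewrite /median_row !mxE.
have neq i j : i != j -> s i != s j by rewrite (inj_eq perm_inj).
have ord3 (i : 'I_3) : [\/ i = inord 0, i = inord 1 | i = inord 2].
  case: i => [[|[|[|//]]]] lt_i3; [apply: Or31|apply: Or32|apply: Or33];
    by apply: val_inj; rewrite /= inordK.
have n01 : s (inord 0) != s (inord 1) by apply: neq; rewrite -val_eqE /= !inordK.
have n02 : s (inord 0) != s (inord 2) by apply: neq; rewrite -val_eqE /= !inordK.
have n12 : s (inord 1) != s (inord 2) by apply: neq; rewrite -val_eqE /= !inordK.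
move: n01 n02 n12.
(* Of the 27 possible triples of images, injectivity of [s] leaves six. The identity closes at once;
   the other five are products of adjacent swaps. *)
case: (ord3 (s (inord 0))) => ->; case: (ord3 (s (inord 1))) => ->;
  case: (ord3 (s (inord 2))) => ->; rewrite ?eqxx // => _ _ _.
- by rewrite median_swapr.
- by rewrite median_swapl.
- by rewrite median_swapr median_swapl.
- by rewrite median_swapl median_swapr.
- by rewrite median_swapl median_swapr median_swapl.
Qed.

Lemma median_row_type2_invariant (R : realType) (m : 'rV[R]_2 -> R) :
  is_mean m -> type2_invariant (@median_row R) m.
Proof.
move=> [_ m_between] a b a0 b0.
have pos_ab : pos_orthant (vec2 a b).
  by move=> i; rewrite mxE; case: i => [[|[|]]].
have [] := m_between _ pos_ab.
rewrite !big_ord_recl !big_ord0 !mxE /= => le_m ge_m.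
rewrite /median_row !mxE !inordK //=; apply: median_between.
  (* The iterated minimum unfolds to one over [a], [b] and the default, which is [a] again; the same
     happens for the maximum. *)
  by apply: le_trans le_m; rewrite !le_min !ge_min !lexx ?orbT.
by apply: le_trans ge_m _; rewrite !ge_max !le_max !lexx ?orbT.
Qed.

Theorem theorem13 (R : realType) (m : 'rV[R]_2 -> R)
    (m_mean : is_mean m) (m_sym : is_symmetric m) :
  exists M : 'rV[R]_3 -> R,
    is_mean M /\ is_symmetric M /\ type2_invariant M m.
Proof.
exists (@median_row R); split; first exact: median_row_is_mean.
by split; [exact: median_row_symmetric | exact: median_row_type2_invariant].
Qed.
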